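(* Let $\mathcal{H}$ be a concept class that is learnable with $d$ non-adaptive statistical queries. Then $\mathcal{H}$ is $\lceil\log\frac{d}{\delta}\rceil$-certificate replicably learnable. Furthermore, the sample complexity $n=n(\nu,\delta)$ of this algorithm equals $O\!\left(\frac{d^2}{\nu^2\delta^2}\cdot\log\frac{d}{\delta}\right)$, where $\nu$ is the approximation error parameter of each statistical query oracle.
   Context: A concept (hypothesis) class $\mathcal{H}$ is a class of Boolean functions $X\to\{0,1\}$ on a domain $X$. For a distribution $\mathcal{D}$ over $X$ and $f\in\mathcal{H}$, $\mathcal{D}_f$ is the distribution over $X\times\{0,1\}$ obtained by sampling $x\sim\mathcal{D}$ and outputting $\langle x,f(x)\rangle$. A hypothesis is a (measurable) function $h:X\to\{0,1\}$; its error is $e_{\mathcal{D}_f}(h)=\Pr_{\langle x,f(x)\rangle\sim\mathcal{D}_f}[f(x)\ne h(x)]$, and it is $\varepsilon$-approximate if $e_{\mathcal{D}_f}(h)\le\varepsilon$. $\log$ is to base $2$. Statistical queries: a statistical query oracle $STAT(\mathcal{D}_f,\nu)$ takes as input a function $\phi:X\times\{0,1\}\to(0,1)$ and returns some estimate $v$ with $|v-E_{\langle x,y\rangle\sim\mathcal{D}_f}[\phi(x,y)]|\le\nu$. An algorithm $A$ learns $\mathcal{H}$ via statistical queries if for every $0<\varepsilon<1$ there is $\nu=\nu(\varepsilon)>0$ such that for every distribution $\mathcal{D}$ over $X$ and every $f\in\mathcal{H}$, $A$ on input $\varepsilon$ and with oracle $STAT(\mathcal{D}_f,\nu)$ outputs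 (for all valid oracle answers) a hypothesis $h$ with $e_{\mathcal{D}_f}(h)\le\varepsilon$. $\mathcal{H}$ is learnable with $d$ non-adaptive statistical queries if such an $A$ exists that makes $d$ queries, none of which depends on answers to other queries. $\ell$-certificate replicably learnable (where $\ell$ may depend on $d,\delta$): there is a learning algorithm $B$ such that for every $f\in\mathcal{H}$, every distribution $\mathcal{D}$ over $X$, and all $0<\varepsilon,\delta<1$, $B$ on inputs $\varepsilon$, $\delta$, $r\in\{0,1\}^\ell$ and $S\sim\mathcal{D}_f^m$ ($m=m(\varepsilon,\delta)$ i.i.d. samples) satisfies $$\Pr_{r\in\{0,1\}^\ell}\Big[\exists\,\varepsilon\text{-approximate hypothesis }h_r:\ \Pr_{S\sim\mathcal{D}_f^m}[B(S;r)=h_r]\ge1-\delta\Big]\ge1-\delta,$$ with $r$ uniform. The number $m$ is the sample complexity and $\ell$ the certificate complexity. The constant in $O(\cdot)$ is absolute.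
   Formalization: In the sample complexity bound the factor log(d/δ) is replaced by max(1, log(d/δ)); this differs only for d = 1 and δ > 1/2, where the literal bound would force zero samples as δ → 1 and is false. Also d ≥ 1 is assumed. *)

(* Defs.v *)
From HB Require Import structures.
From mathcomp Require Import all_boot all_order all_algebra.
From mathcomp Require Import all_classical all_reals all_analysis.

Set Implicit Arguments.
Unset Strict Implicit.
Unset Printing Implicit Defensive.

Import Order.TTheory GRing.Theory Num.Theory.
Import numFieldNormedType.Exports.

Local Open Scope classical_set_scope.
Local Open Scope ring_scope.

Section iid.
Context d (T : measurableType d) (R : realType).

Definition tuple_cons n (z : T * n.-tuple T) : n.+1.-tuple T :=
  [tuple of z.1 :: z.2].

Lemma measurable_tuple_cons n : measurable_fun setT (@tuple_cons n).
Proof. exact: measurable_cons. Qed.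

HB.instance Definition _ n :=
  isMeasurableFun.Build _ _ _ _ (@tuple_cons n) (@measurable_tuple_cons n).

(* The product measure P^m, that is, the law of m i.i.d. samples from P. *)
Fixpoint iid (P : probability T R) (m : nat) : probability (m.-tuple T) R :=
  match m with
  | 0 => dirac [tuple]
  | n.+1 => distribution (P \x iid P n)%E (@tuple_cons n)
  end.

Lemma iid_box (P : probability T R) (m : nat) (A : 'I_m -> set T) :
  (forall i, measurable (A i)) ->
  iid P m [set s | forall i, A i (tnth s i)] = (\prod_(i < m) P (A i))%E.
Proof.
elim: m A => [|n IHn] A mA.
  by rewrite big_ord0 /= diracE mem_set// => -[].
rewrite big_ord_recl -IHn// /= /distribution /pushforward /=.
rewrite -product_measure1E//.
  congr (product_measure1 _ _ _); apply/seteqP; split => [[x s]/= As|[x s]/= [Ax As] i].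
    by split => [|i]; [have := As ord0|have := As (lift ord0 i); rewrite tnthS].
  by case: (unliftP ord0 i) => [j|] ->; rewrite ?tnthS.
rewrite [X in measurable X](_ : _ =
    \big[setI/setT]_(i < n) ((@tnth n T)^~ i @^-1` A (lift ord0 i))).
  apply: bigsetI_measurable => i _; rewrite -[X in measurable X]setTI.
  exact: measurable_tnth.
apply/seteqP; split => s /= As; last first.
  by move=> i; move: As; rewrite (bigD1 i)//= => -[].
by elim/big_ind: _ => //= B1 B2 B1s B2s; split.
Qed.

End iid.

Section learning.
Context disp (X : measurableType disp) (R : realType).

Local Notation hypothesis := {mfun X >-> bool}.

Definition label (f : hypothesis) (x : X) : X * bool := (x, f x).

Lemma measurable_label (f : hypothesis) : measurable_fun setT (label f).
Proof. by apply: measurable_fun_pair => //; exact: measurable_funPT. Qed.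

HB.instance Definition _ (f : hypothesis) :=
  isMeasurableFun.Build _ _ _ _ (label f) (measurable_label f).

Definition labeled (D : probability X R) (f : hypothesis) :
    probability (X * bool)%type R :=
  distribution D (label f).

Definition error (P : probability (X * bool)%type R) (h : hypothesis) : \bar R :=
  P [set z | z.2 != h z.1].

Definition approximate (P : probability (X * bool)%type R) (eps : R)
    (h : hypothesis) : Prop :=
  (error P h <= eps%:E)%E.

(* v is a legal answer of the oracle STAT(P, nu) to the query phi. *)
Definition stat_answer (P : probability (X * bool)%type R) (nu : R)
    (phi : X * bool -> R) (v : R) : Prop :=
  (`| v%:E - 'E_P[phi] | <= nu%:E)%E.

(* On input eps the queries are fixed before any answer is received; the output
   depends on eps and on the vector of answers. *)
Record nonadaptive_sq_algorithm (d : nat) := NonadaptiveSQ {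
  query : R -> 'I_d -> {mfun (X * bool)%type >-> R};
  query_range : forall eps i z, 0 < query eps i z < 1;
  output : R -> ('I_d -> R) -> hypothesis }.

Definition sq_learns (H : set hypothesis) (d : nat)
    (A : nonadaptive_sq_algorithm d) (nu : R -> R) : Prop :=
  forall eps : R, 0 < eps < 1 ->
    0 < nu eps /\
    forall (D : probability X R) (f : hypothesis), H f ->
    forall v : 'I_d -> R,
      (forall i, stat_answer (labeled D f) (nu eps) (query A eps i) (v i)) ->
      approximate (labeled D f) eps (output A eps v).

Definition nonadaptive_sq_learnable (H : set hypothesis) (d : nat)
    (nu : R -> R) : Prop :=
  exists A : nonadaptive_sq_algorithm d, sq_learns H A nu.

Definition uniform_pr (l : nat) (E : l.-tuple bool -> Prop) : R :=
  #|[set r : l.-tuple bool | `[< E r >]]%SET|%:R / 2 ^+ l.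

Definition certificate_learner (l : R -> nat) (m : R -> R -> nat) :=
  forall eps delta : R,
    (m eps delta).-tuple (X * bool)%type -> (l delta).-tuple bool -> hypothesis.

(* The first conjunct makes the inner probability meaningful: measures are total
   functions on sets, with unspecified values on nonmeasurable ones. *)
Definition certificate_replicable (H : set hypothesis) (l : R -> nat)
    (m : R -> R -> nat) (B : certificate_learner l m) : Prop :=
  forall eps delta : R, 0 < eps < 1 -> 0 < delta < 1 ->
    (forall r h, measurable [set S | B eps delta S r = h]) /\
    forall (D : probability X R) (f : hypothesis), H f ->
      1 - delta <= uniform_pr (fun r : (l delta).-tuple bool =>
        exists h : hypothesis, approximate (labeled D f) eps h /\
          ((1 - delta)%:E <= iid (labeled D f) (m eps delta)
                               [set S | B eps delta S r = h])%E).

Definition certificate_replicably_learnable (H : set hypothesis)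
    (l : R -> nat) (m : R -> R -> nat) : Prop :=
  exists B : certificate_learner l m, certificate_replicable H B.

End learning.

Definition log2 {R : realType} (x : R) : R := ln x / ln 2.

(* For 0 < d and delta < 1 the ceiling is positive, so absz does not alter it. *)
Definition certificate_length {R : realType} (d : nat) (delta : R) : nat :=
  `|Num.ceil (log2 (d%:R / delta))|%N.

(* d^2 / (nu^2 delta^2) log (d / delta), where the logarithmic factor is
   replaced by 1 if it is smaller, that is, if d = 1 and 1/2 < delta.  There the
   logarithm tends to 0 as delta tends to 1 and, nu being fixed, no constant makes
   the bound allow even one sample. *)
Definition sample_bound {R : realType} (d : nat) (nu delta : R) : R :=
  d%:R ^+ 2 / (nu ^+ 2 * delta ^+ 2) * Num.max 1 (log2 (d%:R / delta)).

(* Main.v *)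
(* Answer each query by the empirical mean of the sample, rounded to the midpoint
   of its cell in a grid of width 2 nu.  The grid is shifted by (r / K) 2 nu, where
   r < K = 2 ^ l is encoded by the random string and the shift is common to all
   queries.  Rounding moves a value by at most nu, so the rounded true means are
   legal answers.  The empirical means are within nu / K of the true ones by a
   Chernoff bound, and are then rounded to the same midpoints unless some grid point
   is within nu / K of a true mean; since the K grids interleave with spacing
   2 nu / K, each query rules out at most one r, and d / K <= delta. *)

Require Import Defs.
From mathcomp Require Import all_boot all_order all_algebra.
From mathcomp Require Import all_classical all_reals all_analysis.
From mathcomp Require Import measurable_realfun.
From mathcomp Require Import ring lra zify.

Set Implicit Arguments.
Unset Strict Implicit.
Unset Printing Implicit Defensive.

Import Order.TTheory GRing.Theory Num.Theory.
Import numFieldNormedType.Exports.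

Local Open Scope classical_set_scope.
Local Open Scope ring_scope.

(** * Exponential moments of bounded centered variables *)

Lemma expR_le_quadratic (R : realType) (x : R) :
  x <= 2^-1 -> expR x <= 1 + x + 2 * x ^+ 2.
Proof.
move=> x2.
have e := expR_ge1Dx (- x).
have e0 := expR_gt0 (- x).
have -> : expR x = (expR (- x))^-1 by rewrite expRN invrK.
rewrite -[leLHS]mul1r ler_pdivrMr//.
have q0 : 0 < 1 + x + 2 * x ^+ 2 by nra.
(* It is enough to compare with [1 - x <= expR (- x)]: the product expands to
   [1 + x ^+ 2 * (1 - 2 * x)], and the last factor is nonnegative for [x <= 2^-1]. *)
apply: (@le_trans _ _ ((1 + x + 2 * x ^+ 2) * (1 + - x))); last by rewrite ler_pM2l.
have : 0 <= x ^+ 2 * (1 - 2 * x) by apply: mulr_ge0; [exact: sqr_ge0|lra].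
nra.
Qed.

Section mgf.
Context d (T : measurableType d) (R : realType) (P : probability T R).
Implicit Types phi : {mfun T >-> R}.

Lemma integrable_le1 phi : (forall z, `|phi z| <= 1) ->
  P.-integrable setT (EFin \o phi).
Proof.
move=> phi1; apply: (le_integrable (g := EFin \o cst 1) measurableT).
- exact/measurable_EFinP.
- by move=> z _ /=; rewrite lee_fin normr1.
- exact: finite_measure_integrable_cst.
Qed.

(** Pointwise, the quadratic bound on the exponential gives [1 + t * phi z + 2 * t ^+ 2]. The linear
    term integrates to zero, and [1 + y <= expR y] turns the rest back into an exponential. *)
Lemma centered_mgf_le phi t : (forall z, `|phi z| <= 1) -> ('E_P[phi] = 0)%E ->
  `|t| <= 2^-1 -> ('M_P phi t <= (expR (2 * t ^+ 2))%:E)%E.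
Proof.
move=> phi1 phi0 t2; rewrite /mmt_gen_fun [@expectation]unlock.
have iphi := integrable_le1 phi1.
apply: (@le_trans _ _ (\int[P]_z ((1 + 2 * t ^+ 2)%:E + t%:E * (phi z)%:E))%E).
  apply: ge0_le_integral => //=.
  - by apply/measurable_EFinP; apply: measurableT_comp => //; exact: measurable_funM.
  - apply: emeasurable_funD => //; apply: measurable_funeM; exact/measurable_EFinP.
  - move=> z _; rewrite -EFinM -EFinD lee_fin.
    have := phi1 z; move: t2; rewrite !ler_norml => /andP[a1 a2] /andP[b1 b2].
    have tz : `|phi z * t| <= 2^-1.
      by rewrite normrM -[2^-1]mul1r ler_pM// ler_norml; apply/andP.
    apply: (le_trans (expR_le_quadratic (le_trans (ler_norm _) tz))).
    have : (phi z * t) ^+ 2 <= t ^+ 2.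
      rewrite exprMn ler_piMl ?sqr_ge0//.
      by rewrite -real_normK ?num_real// expr_le1.
    lra.
rewrite integralD//; [|exact: finite_measure_integrable_cst|exact: integrableZl].
rewrite integral_cst//= probability_setT mule1 integralZl//.
have -> : (\int[P]_x (phi x)%:E = 0)%E by move: phi0; rewrite [@expectation]unlock.
rewrite mule0 adde0 lee_fin.
exact: expR_ge1Dx.
Qed.

End mgf.

(** * Products of functions of independent samples *)

Section iid_hoeffding.
Context d (T : measurableType d) (R : realType) (P : probability T R).

Lemma measurable_iid_prod m (g : T -> R) : measurable_fun setT g ->
  measurable_fun setT (fun s : m.-tuple T => \prod_(i < m) g (tnth s i)).
Proof.
move=> mg; apply: measurable_prod => i _.
by apply: measurableT_comp => //; exact: measurable_tnth.
Qed.

(** Tonelli splits off the first sample, and induction handles the others. This is the form in which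
    independence enters: it makes the moment generating function of a sum a power. *)
Lemma integral_iid_prod m (g : T -> R) : measurable_fun setT g ->
  (forall x, 0 <= g x) ->
  (\int[iid P m]_s (\prod_(i < m) g (tnth s i))%:E =
   (\int[P]_x (g x)%:E) ^+ m)%E.
Proof.
move=> mg g0; elim: m => [|m IHm].
  rewrite /= integral_dirac//= ?diracT ?big_ord0 ?mule1//.
  by apply/measurable_EFinP; exact: measurable_iid_prod.
have mprod n := @measurable_iid_prod n g mg.
have prod0 n (s : n.-tuple T) : 0 <= \prod_(i < n) g (tnth s i) by exact: prodr_ge0.
rewrite [iid P _]/= ge0_integral_distribution; last 2 first.
- by apply/measurable_EFinP; exact: mprod.
- by move=> s; rewrite lee_fin.
have E (z : T * m.-tuple T) : ((\prod_(i < m.+1) g (tnth (tuple_cons z) i))%:E =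
    (g z.1)%:E * (\prod_(i < m) g (tnth z.2 i))%:E)%E.
  rewrite -EFinM big_ord_recl; congr (_ * _)%:E.
  by apply: eq_bigr => i _; rewrite tnthS.
rewrite (eq_integral (fun z : T * m.-tuple T =>
    (g z.1)%:E * (\prod_(i < m) g (tnth z.2 i))%:E)%E); last by move=> z _; exact: E.
rewrite fubini_tonelli1; last 2 first.
- apply: emeasurable_funM; apply/measurable_EFinP.
    exact: (measurableT_comp mg measurable_fst).
  exact: (measurableT_comp (mprod m) measurable_snd).
- by move=> z; rewrite mule_ge0// lee_fin.
rewrite (eq_integral (fun x => (g x)%:E * (\int[P]_x (g x)%:E) ^+ m)%E); last first.
  move=> x _; rewrite /fubini_F /= ge0_integralZl//.
  - by rewrite IHm.
  - by apply/measurable_EFinP; exact: mprod.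
  - by move=> y _; rewrite lee_fin; exact: prod0.
  - by rewrite lee_fin.
rewrite expeS ge0_integralZr//.
- exact/measurable_EFinP.
- by move=> y _; rewrite lee_fin.
- by apply: expe_ge0; apply: integral_ge0 => x _; rewrite lee_fin.
Qed.

End iid_hoeffding.

(** * Concentration of sample means *)

Section mean_deviation.
Context d (T : measurableType d) (R : realType) (P : probability T R).

Lemma measurable_tuple_sum m (phi : {mfun T >-> R}) :
  measurable_fun setT (fun s : m.-tuple T => \sum_(i < m) phi (tnth s i)).
Proof.
apply: measurable_sum => i.
by apply: measurableT_comp => //; exact: measurable_tnth.
Qed.

Lemma iid_sum_tail m (phi : {mfun T >-> R}) (a : R) :
  (forall z, `|phi z| <= 1) -> ('E_P[phi] = 0)%E -> 0 < a <= 2 ->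
  (iid P m [set s | (m%:R * a <= \sum_(i < m) phi (tnth s i))%R] <=
   (expR (- (m%:R * a ^+ 2 / 8)))%:E)%E.
Proof.
move=> phi1 phi0 /andP[a0 a2].
have mS := @measurable_tuple_sum m phi.
(* The Chernoff exponent [m * (2 * t ^+ 2 - t * a)] is minimal at [t = a / 4], with value
   [- m * a ^+ 2 / 8]. The hypothesis [a <= 2] keeps [t] below [2^-1], as the moment bound
   requires. *)
have t0 : 0 < a / 4 by lra.
apply: (le_trans (chernoff (mfun_Sub (mem_set mS) : {RV (iid P m) >-> R}) _ t0)).
have -> : 'M_(iid P m) (mfun_Sub (mem_set mS)) (a / 4) = (('M_P phi (a / 4)) ^+ m)%E.
  rewrite /mmt_gen_fun [@expectation]unlock.
  rewrite -(@integral_iid_prod _ _ _ _ m (expR \o (a / 4) \o* phi)).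
  - by apply: eq_integral => s _ /=; rewrite mulr_suml expR_sum.
  - by apply: measurableT_comp => //; exact: measurable_funM.
  - by move=> x; exact: expR_ge0.
apply: (@le_trans _ _ ((expR (2 * (a / 4) ^+ 2))%:E ^+ m *
    (expR (- (a / 4 * (m%:R * a))))%:E)%E).
  apply: lee_wpmul2r; first by rewrite lee_fin expR_ge0.
  have M0 : (0 <= 'M_P phi (a / 4))%E by apply: expectation_ge0 => x; exact: expR_ge0.
  have Mle : ('M_P phi (a / 4) <= (expR (2 * (a / 4) ^+ 2))%:E)%E.
    apply: centered_mgf_le => //; rewrite ger0_norm; lra.
  elim: m {mS} => [|m IHm]; first by rewrite !expe0.
  by rewrite !expeS; apply: lee_pmul => //; exact: expe_ge0.
rewrite -EFin_expe -EFinM lee_fin -expRM_natl -expRD ler_expR.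
lra.
Qed.

Lemma measurable_superlevel d' (S : measurableType d') (f : S -> R) (a : R) :
  measurable_fun setT f -> measurable [set s | a <= f s].
Proof.
move=> mf; rewrite -[X in measurable X]setTI.
have := mf measurableT `[a, +oo[%classic (measurable_itv _).
congr (measurable (_ `&` _)); apply/seteqP.
by split=> s /=; rewrite in_itv/= andbT.
Qed.

Definition sample_mean m (q : T -> R) (s : m.-tuple T) : R :=
  (\sum_(i < m) q (tnth s i)) / m%:R.

Lemma measurable_sample_mean m (q : {mfun T >-> R}) :
  measurable_fun setT (@sample_mean m q).
Proof. by apply: measurable_funM => //; exact: measurable_tuple_sum. Qed.

Lemma measurable_sample_mean_far m (q : {mfun T >-> R}) (p a : R) :
  measurable [set s : m.-tuple T | a <= `|sample_mean q s - p|].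
Proof.
apply: measurable_superlevel; apply: measurableT_comp => //.
by apply: measurable_funB => //; exact: measurable_sample_mean.
Qed.

Lemma expectation_unit (q : {mfun T >-> R}) : (forall z, 0 < q z < 1) ->
  exists2 p, ('E_P[q] = p%:E)%E & 0 <= p <= 1.
Proof.
move=> q01.
have E0 : (0 <= 'E_P[q])%E.
  by apply: expectation_ge0 => z; have /andP[/ltW] := q01 z.
have E1 : ('E_P[q] <= 1)%E.
  rewrite -(expectation_cst P 1); apply: expectation_le => //.
  - by move=> z; have /andP[/ltW] := q01 z.
  - by apply/aeW => z; have /andP[_ /ltW] := q01 z.
have Efin : 'E_P[q]%E \is a fin_num.
  by rewrite fin_numElt (lt_le_trans _ E0)// (le_lt_trans E1)// ltry.
by exists (fine 'E_P[q]); rewrite -?lee_fin -?lee_fin ?fineK// E0.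
Qed.

(** The one-sided tail bound is applied to [q - p] and to [p - q]. Both are centered, and bounded by
    1 because [q] and its mean lie in the unit interval. Their union costs the factor 2. *)
Lemma iid_sample_mean_tail m (q : {mfun T >-> R}) (p a : R) : (0 < m)%N ->
  (forall z, 0 < q z < 1) -> ('E_P[q] = p%:E)%E -> 0 < a <= 2 ->
  (iid P m [set s | (a <= `|sample_mean q s - p|)%R] <=
   (2 * expR (- (m%:R * a ^+ 2 / 8)))%:E)%E.
Proof.
move=> m0 q01 qp a02.
have mpos : 0 < m%:R :> R by rewrite ltr0n.
have iq : P.-integrable setT (EFin \o q).
  by apply: integrable_le1 => z; have /andP[? ?] := q01 z; rewrite ger0_norm ltW.
have icst r : P.-integrable setT (EFin \o cst r) by exact: finite_measure_integrable_cst.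
have p01 : 0 <= p <= 1.
  by have [r] := expectation_unit q01; rewrite qp => -[->].
have mu : measurable_fun setT (fun z => q z - p) by exact: measurable_funB.
have ml : measurable_fun setT (fun z => p - q z) by exact: measurable_funB.
pose u : {mfun T >-> R} := mfun_Sub (mem_set mu).
pose l : {mfun T >-> R} := mfun_Sub (mem_set ml).
have u1 z : `|u z| <= 1.
  by rewrite ler_norml /=; have := q01 z; lra.
have l1 z : `|l z| <= 1.
  by rewrite ler_norml /=; have := q01 z; lra.
have u0 : ('E_P[u] = 0)%E.
  rewrite (_ : u = q \- cst p :> (T -> R))// expectationB; last 2 first.
  - exact/Lfun1_integrable.
  - exact/Lfun1_integrable.
  by rewrite qp expectation_cst subee.
have l0 : ('E_P[l] = 0)%E.
  rewrite (_ : l = cst p \- q :> (T -> R))// expectationB; last 2 first.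
  - exact/Lfun1_integrable.
  - exact/Lfun1_integrable.
  by rewrite qp expectation_cst subee.
have su (s : m.-tuple T) : \sum_(i < m) u (tnth s i) = m%:R * (sample_mean q s - p).
  rewrite /= sumrB sumr_const card_ord mulrBr /sample_mean mulrC divfK ?gt_eqF//.
  by rewrite mulr_natl.
have sl (s : m.-tuple T) : \sum_(i < m) l (tnth s i) = m%:R * (p - sample_mean q s).
  rewrite /= sumrB sumr_const card_ord mulrBr /sample_mean [in RHS](mulrC _ (_ / _)).
  by rewrite divfK ?gt_eqF// mulr_natl.
have mtail (phi : {mfun T >-> R}) :
    measurable [set s : m.-tuple T | m%:R * a <= \sum_(i < m) phi (tnth s i)].
  by apply: measurable_superlevel; exact: measurable_tuple_sum.
apply: (@le_trans _ _ (iid P m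
    ([set s | (m%:R * a <= \sum_(i < m) u (tnth s i))%R] `|`
     [set s | (m%:R * a <= \sum_(i < m) l (tnth s i))%R]))).
  apply: le_measure; rewrite ?inE.
  - exact: measurable_sample_mean_far.
  - exact: measurableU.
  - by move=> s /=; rewrite su sl !ler_pM2l// ler_normr opprB => /orP.
rewrite [2 * _]mulrDl mul1r EFinD; apply: (le_trans (measureU2 _ _ _)) => //.
by apply: leeD; exact: iid_sum_tail.
Qed.

(** The complement of a finite union gives both measurability and access to the union bound over the
    queries. *)
Lemma sample_means_closeE (k m : nat) (q : 'I_k -> {mfun T >-> R})
    (p : 'I_k -> R) (a : R) :
  [set s : m.-tuple T | forall i, `|sample_mean (q i) s - p i| < a] =
  ~` \big[setU/set0]_(i < k) [set s | a <= `|sample_mean (q i) s - p i|].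
Proof.
rewrite -bigcup_seq setC_bigcup; apply/seteqP; split=> s /=.
  by move=> close i _; apply/negP; rewrite -ltNge.
move=> close i; rewrite ltNge; apply/negP; apply: close => /=.
exact: mem_index_enum.
Qed.

Lemma measurable_sample_means_close (k m : nat) (q : 'I_k -> {mfun T >-> R})
    (p : 'I_k -> R) (a : R) :
  measurable [set s : m.-tuple T | forall i, `|sample_mean (q i) s - p i| < a].
Proof.
rewrite sample_means_closeE; apply/measurableC/bigsetU_measurable => i _.
exact: measurable_sample_mean_far.
Qed.

Lemma iid_sample_means_close (k m : nat) (q : 'I_k -> {mfun T >-> R})
    (p : 'I_k -> R) (a : R) : (0 < m)%N ->
  (forall i z, 0 < q i z < 1) -> (forall i, 'E_P[q i] = (p i)%:E)%E -> 0 < a <= 2 ->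
  ((1 - k%:R * (2 * expR (- (m%:R * a ^+ 2 / 8))))%:E <=
   iid P m [set s | (forall i, `|sample_mean (q i) s - p i| < a)%R])%E.
Proof.
move=> m0 q01 qp a02.
pose far i := [set s : m.-tuple T | a <= `|sample_mean (q i) s - p i|].
have mfar i : measurable (far i) by exact: measurable_sample_mean_far.
rewrite sample_means_closeE probability_setC; last first.
  by apply: bigsetU_measurable => i _; exact: mfar.
rewrite EFinB leeB//.
apply: (@le_trans _ _ (\sum_(i < k) iid P m (far i))%E).
  elim: (index_enum _) => [|i r IHr]; first by rewrite !big_nil measure0.
  rewrite !big_cons; apply: le_trans (leeD (lexx _) IHr).
  apply: measureU2; first exact: mfar.
  by apply: bigsetU_measurable => j _; exact: mfar.
apply: (@le_trans _ _ (\sum_(i < k) (2 * expR (- (m%:R * a ^+ 2 / 8)))%:E)%E).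
  by apply: lee_sum => i _; exact: iid_sample_mean_tail.
by rewrite sumEFin sumr_const card_ord -(mulr_natl (2 * _) k).
Qed.

End mean_deviation.

(** * Rounding on shifted grids *)

Lemma eq_of_near_congruent (a b K : nat) (D : int) : (a < K)%N -> (b < K)%N ->
  `|b%:Z - a%:Z + K%:Z * D| < 1 -> a = b.
Proof.
rewrite ltr_norml => aK bK.
(* Since [b - a] has absolute value at most [K - 1], adding a nonzero multiple of [K] cannot bring
   it below 1. So [D = 0], and an integer of absolute value below 1 vanishes. *)
have [D0|D0|->] := ltgtP D 0.
- have : K%:Z * D <= - K%:Z by nia.
  lia.
- have : K%:Z <= K%:Z * D by nia.
  lia.
- rewrite mulr0; lia.
Qed.

Section shifted_grid.
Context {R : realType}.

(** The grid points are [w * (n + o)] for integers [n]. The summand [2^-1] selects the midpoint of a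
    cell, so that the error is half the width. *)
Definition round_at (w o y : R) : R :=
  w * ((Num.floor (y / w - o))%:~R + o + 2^-1).

Lemma round_at_error w o y : 0 < w -> `|round_at w o y - y| <= w / 2.
Proof.
move=> w0; rewrite /round_at.
have /andP[] := floor_itv (y / w - o); rewrite intrD.
set k := (Num.floor _)%:~R => k1 k2.
have -> : w * (k + o + 2^-1) - y = w * (k + o + 2^-1 - y / w).
  by rewrite [RHS]mulrBr mulrCA divff ?gt_eqF// mulr1.
rewrite normrM (gtr0_norm w0) ler_pM2l// ler_norml; lra.
Qed.

Definition near_int (e x : R) : Prop := exists n : int, `|x - n%:~R| < e.

(** If the floors differed, [Num.floor x] or its successor would separate [x] from [y] and thus lie
    within [e] of [x]. *)
Lemma floor_eq_near e x y : ~ near_int e x -> `|y - x| < e ->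
  Num.floor y = Num.floor x.
Proof.
move=> far; rewrite ltr_norml => /andP[yx1 yx2].
have /andP[x1 x2] := floor_itv x; apply: floor_def.
rewrite leNgt [X in _ && X]ltNge; apply/andP; split; apply/negP => yn; apply: far.
  by exists (Num.floor x); rewrite ger0_norm; lra.
by exists (Num.floor x + 1); rewrite ler0_norm; lra.
Qed.

Context {T : finType}.

Definition offset (r : T) : R := (enum_rank r)%:R / #|T|%:R.

(** The radius is half the spacing of the shifts. By the triangle inequality the two shifts differ
    by less than one spacing modulo 1; after scaling by [#|T|], the ranks differ by less than 1
    modulo [#|T|]. *)
Lemma offset_near_int_inj (x : R) (r r' : T) :
  near_int (2 * #|T|%:R)^-1 (x - offset r) ->
  near_int (2 * #|T|%:R)^-1 (x - offset r') -> r = r'.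
Proof.
move=> [n rn] [n' rn'].
have T0 : (0 < #|T|)%N by apply/card_gt0P; exists r.
have K0 : 0 < #|T|%:R :> R by rewrite ltr0n.
have : `|(enum_rank r')%:Z - (enum_rank r)%:Z + #|T|%:Z * (n' - n)| < 1 :> int.
  rewrite -(ltr_int R) intr_norm !(intrD, intrN, intrM).
  rewrite -(ltr_pM2r (_ : 0 < #|T|%:R^-1)) ?invr_gt0//.
  rewrite -{1}(gtr0_norm (_ : 0 < #|T|%:R^-1)) ?invr_gt0// -normrM.
  rewrite [X in `|X|](_ : _ =
     (x - offset r - n%:~R) - (x - offset r' - n'%:~R)); last first.
    by rewrite /offset -!pmulrn; field; rewrite gt_eqF.
  apply: (le_lt_trans (ler_normB _ _)).
  have -> : 1 / #|T|%:R = (2 * #|T|%:R)^-1 + (2 * #|T|%:R)^-1 :> R.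
    by field; rewrite gt_eqF.
  exact: ltrD.
move=> h; apply: (can_inj enum_rankK); apply: val_inj => /=.
exact: eq_of_near_congruent (ltn_ord _) (ltn_ord _) h.
Qed.

Lemma card_near_int_le d (x : 'I_d -> R) :
  (#|[set r : T | `[< exists i, near_int (2 * #|T|%:R)^-1 (x i - offset r) >]]%SET|
   <= d)%N.
Proof.
pose bad i := [set r : T | `[< near_int (2 * #|T|%:R)^-1 (x i - offset r) >]]%SET.
rewrite (_ : [set r : T | _]%SET = (\bigcup_i bad i)%SET); last first.
  apply/setP => r; rewrite inE; apply/asboolP/bigcupP => -[i].
    by move=> near; exists i => //; rewrite inE; apply/asboolP.
  by move=> _; rewrite inE => /asboolP near; exists i.
apply: (@leq_trans (\sum_(i < d) 1)); last by rewrite sum1_card card_ord.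
elim/big_rec2 : _ => [|i k B _ IH]; first by rewrite cards0.
apply: (leq_trans (leq_card_setU _ _)); apply: leq_add => //.
apply/card_le1_eqP => r r'; rewrite !finset.in_set => /asboolP rn /asboolP r'n.
exact: offset_near_int_inj r'n rn.
Qed.

End shifted_grid.

(** * Counting random strings, and measurability of statistics with countably many values *)

Lemma uniform_pr_ge (R : realType) l d (delta : R) (E F : l.-tuple bool -> Prop) :
  (#|[set r | `[< F r >]]%SET| <= d)%N -> d%:R / 2 ^+ l <= delta ->
  (forall r, ~ F r -> E r) -> 1 - delta <= uniform_pr R E.
Proof.
move=> Fd dl FE; rewrite /uniform_pr.
have l0 : 0 < 2 ^+ l :> R by rewrite exprn_gt0.
rewrite ler_pdivlMr// mulrBl mul1r.
rewrite ler_pdivrMr// in dl.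
(* [E] and [F] together cover all strings. *)
have : (2 ^ l <= #|[set r : l.-tuple bool | `[< E r >]]%SET| + d)%N.
  rewrite -[X in (X ^ _)%N]card_bool -(card_tuple l bool).
  rewrite -cardsT.
  apply: (@leq_trans #|([set r | `[< E r >]] :|: [set r | `[< F r >]])%SET|).
    apply: subset_leq_card; apply/fintype.subsetP => r _; rewrite !inE.
    by apply/orP; have [Fr|/FE Er] := pselect (F r); [right|left]; apply/asboolP.
  by apply: (leq_trans (leq_card_setU _ _)); rewrite leq_add2l.
by rewrite -(ler_nat R) natrD natrX => h; lra.
Qed.

(** The event is a countable union of fibers of [c]. The type [U] carries no sigma-algebra, which
    suits values that are hypotheses. *)
Lemma measurable_fiber_count dT (T : measurableType dT) (I : countType) U
    (c : T -> I) (G : I -> U) (u : U) :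
  (forall k, measurable [set s | c s = k]) -> measurable [set s | G (c s) = u].
Proof.
move=> mc; rewrite (_ : [set s | _] =
    \bigcup_(k in [set: I]) (if `[< G k = u >] then [set s | c s = k] else set0)).
  apply: countable_bigcupT_measurable => [|k]; first exact: countableP.
  by case: ifP.
apply/seteqP; split=> s /=.
  by move=> Gu; exists (c s) => //; rewrite ifT//; apply/asboolP.
by move=> [k _]; case: ifPn => // /asboolP <- /= ->.
Qed.

Lemma measurable_floor_eq dT (T : measurableType dT) (R : realType) (f : T -> R)
    (n : int) :
  measurable_fun setT f -> measurable [set s | Num.floor (f s) = n].
Proof.
move=> mf; rewrite -[X in measurable X]setTI.
have := mf measurableT `[n%:~R, (n + 1)%:~R[%classic (measurable_itv _).
congr (measurable (_ `&` _)); apply/seteqP.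
by split=> s /=; rewrite in_itv/= -floor_eq => /eqP.
Qed.

(** * Certificate length and sample size *)

Section bounds.
Context {R : realType}.
Implicit Types (d : nat) (delta v : R).

Lemma ln2_gt0 : 0 < ln 2 :> R. Proof. by rewrite ln_gt0// ltr1n. Qed.

(** The lower bound makes the fraction of bad strings at most [delta]. The upper bound limits how
    fine the shifts are, hence the accuracy that the sample must reach. *)
Lemma certificate_length_bounds d delta : (0 < d)%N -> 0 < delta < 1 ->
  d%:R / delta <= 2 ^+ certificate_length d delta < 2 * (d%:R / delta).
Proof.
move=> d0 /andP[delta0 delta1].
have x1 : 1 < d%:R / delta.
  by rewrite ltr_pdivlMr// mul1r (lt_le_trans delta1)// ler1n.
have x0 : 0 < d%:R / delta by exact: lt_trans x1.
have ln2 := ln2_gt0.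
have log0 : 0 < log2 (d%:R / delta) by rewrite divr_gt0// ln_gt0.
set x := d%:R / delta in x1 x0 log0 *.
have : ((certificate_length d delta)%:R = (Num.ceil (log2 x))%:~R :> R).
  by rewrite natr_absz gtr0_norm// ceil_gt0.
move: (certificate_length _ _) => l lE.
have /andP[] := ceil_itv (log2 x); rewrite intrB -lE => l1 l2.
have -> : 2 ^+ l = expR (l%:R * ln 2) :> R by rewrite expRM_natl lnK// posrE.
have xE : x = expR (log2 x * ln 2) by rewrite divfK ?gt_eqF// lnK// posrE.
have -> : 2 * x = expR ((log2 x + 1) * ln 2).
  by rewrite [in RHS]mulrDl mul1r expRD -xE lnK ?posrE// mulrC.
rewrite {1}xE ler_expR ltr_expR !ler_pM2r// ltr_pM2r// l2/=; lra.
Qed.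

(** Ensures a nonempty sample and pays for truncating a real sample size to an integer. *)
Lemma sample_bound_ge1 d v delta : (0 < d)%N -> 0 < v < 1 -> 0 < delta < 1 ->
  1 <= sample_bound d v delta.
Proof.
move=> d0 /andP[v0 v1] /andP[delta0 delta1].
rewrite /sample_bound -[leLHS]mulr1 ler_pM//; last by rewrite le_max lexx.
rewrite ler_pdivlMr ?mul1r ?mulr_gt0 ?exprn_gt0//.
apply: (@le_trans _ _ 1); last by rewrite exprn_ege1// ler1n.
by rewrite -exprMn expr_le1// ?mulr_ge0 ?ltW// mulr_ilt1// ltW.
Qed.

(** The accuracy [v / K] exceeds [v * delta / (2 * d)], so the exponent is at least
    [ln (2 * d / delta)]. Each of the [d] queries then fails with probability at most
    [delta / d]. *)
Lemma tail_le_delta d v delta (m : nat) : (0 < d)%N -> 0 < v -> 0 < delta < 1 ->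
  64 * sample_bound d v delta <= m%:R ->
  d%:R * (2 * expR (- (m%:R * (v / 2 ^+ certificate_length d delta) ^+ 2 / 8)))
    <= delta.
Proof.
move=> d0 v0 delta01 ms.
have /andP[delta0 delta1] := delta01.
have /andP[_ Kle] := certificate_length_bounds d0 delta01.
set K := 2 ^+ _ in Kle *.
have K0 : 0 < K by rewrite exprn_gt0.
have dR : 0 < d%:R :> R by rewrite ltr0n.
have ln2 := ln2_gt0.
have ln21 : ln 2 <= 1 :> R.
  by apply: (@le_ln1Dx R 1); rewrite (lt_trans _ ltr01)// oppr_lt0.
set M := Num.max 1 (log2 (d%:R / delta)).
(* One [M] covers the additional [ln 2], through the maximum with 1; the other covers the logarithm
   of [d / delta]. *)
have lnM : ln (2 * (d%:R / delta)) <= 2 * M.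
  rewrite lnM ?posrE ?divr_gt0//.
  have -> : ln (d%:R / delta) = log2 (d%:R / delta) * ln 2.
    by rewrite divfK// gt_eqF.
  have M1 : 1 <= M by rewrite le_max lexx.
  have M2 : log2 (d%:R / delta) <= M by rewrite le_max lexx orbT.
  have : log2 (d%:R / delta) * ln 2 <= M * ln 2 by rewrite ler_pM2r.
  have : M * ln 2 <= M * 1 by rewrite ler_pM2l// (lt_le_trans ltr01).
  lra.
have a2 : delta ^+ 2 * v ^+ 2 / (4 * d%:R ^+ 2) <= (v / K) ^+ 2.
  rewrite (_ : _ / _ = (v / (2 * (d%:R / delta))) ^+ 2); last first.
    by field; rewrite !gt_eqF.
  have w0 : 0 < 2 * (d%:R / delta) by rewrite mulr_gt0// divr_gt0.
  apply: lerXn2r; rewrite ?nnegrE ?divr_ge0 ?(ltW v0) ?(ltW w0) ?(ltW K0)//.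
  by rewrite ler_pM2l// lef_pV2// ltW.
(* The constant 64 is the product of this 2, the 8 of the tail exponent and the 4 from squaring
   [K < 2 * (d / delta)]. *)
have big : 2 * M <= m%:R * (v / K) ^+ 2 / 8.
  rewrite ler_pdivlMr//.
  apply: (le_trans _ (ler_pM _ _ ms a2)).
  - rewrite le_eqVlt; apply/orP; left; apply/eqP; rewrite /sample_bound -/M.
    by field; rewrite !gt_eqF.
  - rewrite !mulr_ge0 ?invr_ge0 ?mulr_ge0 ?exprn_ge0 ?ltW//.
    by rewrite lt_max ltr01.
  - by rewrite !mulr_ge0 ?invr_ge0 ?mulr_ge0 ?exprn_ge0 ?ltW.
have : expR (- (m%:R * (v / K) ^+ 2 / 8)) <= (2 * (d%:R / delta))^-1.
  rewrite -[leRHS]lnK ?posrE ?invr_gt0 ?mulr_gt0 ?invr_gt0//.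
  rewrite ler_expR lnV ?posrE ?mulr_gt0 ?invr_gt0// lerN2.
  exact: le_trans big.
move=> /(ler_wpM2l (ltW (mulr_gt0 dR (ltr0n R 2)))).
rewrite -mulrA => /le_trans; apply.
rewrite le_eqVlt; apply/orP; left; apply/eqP.
by field; rewrite !gt_eqF.
Qed.

End bounds.

(** * The rounding learner and its replicability *)

Section learner.
Context disp (X : measurableType disp) (R : realType).
Variables (d : nat) (A : nonadaptive_sq_algorithm X R d) (nu : R -> R).
Variables (l : R -> nat) (m : R -> R -> nat).

Definition rounded_answers eps delta (r : (l delta).-tuple bool) (v : 'I_d -> R)
    (i : 'I_d) : R :=
  round_at (2 * nu eps) (offset r) (v i).

(* Since queries take values in (0, 1), the answer 1/2 has tolerance 1 without
   looking at the sample, which may be empty when nu is large. *)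
Definition rounding_learner : certificate_learner X l m := fun eps delta S r =>
  output A eps (if 1 <= nu eps then fun=> 2^-1 else
    rounded_answers eps r (fun i => sample_mean (query A eps i) S)).

(** For [nu eps < 1] the output depends on the sample only through the finite vector of integer cell
    indices, which takes countably many values. Otherwise it is constant. *)
Lemma measurable_rounding_learner eps delta r h :
  measurable [set S | @rounding_learner eps delta S r = h].
Proof.
rewrite /rounding_learner; case: (1 <= nu eps).
  have [<-|nh] := pselect (output A eps (fun=> 2^-1) = h).
    by rewrite (_ : [set S | _] = setT)//; apply/seteqP.
  by rewrite (_ : [set S | _] = set0)//; apply/seteqP; split.
pose c (S : (m eps delta).-tuple (X * bool)%type) : {ffun 'I_d -> int} := [ffun i =>
  Num.floor (sample_mean (query A eps i) S / (2 * nu eps) - offset r)].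
pose G (k : {ffun 'I_d -> int}) :=
  output A eps (fun i => 2 * nu eps * ((k i)%:~R + offset r + 2^-1)).
rewrite (_ : [set S | _] = [set S | G (c S) = h]); last first.
  apply/seteqP; split=> S /= <-; rewrite /G; congr (output A eps).
    by apply/funext => i; rewrite ffunE.
  by apply/funext => i; rewrite ffunE.
apply: measurable_fiber_count => k.
rewrite (_ : [set S | _] = \bigcap_(i in [set: 'I_d])
    [set S | Num.floor (sample_mean (query A eps i) S / (2 * nu eps) - offset r) = k i]).
  apply: fin_bigcap_measurable => // i _; apply: measurable_floor_eq.
  apply: measurable_funB => //; apply: measurable_funM => //.
  exact: measurable_sample_mean.
apply/seteqP; split=> S /=.
  by move=> <- i _ /=; rewrite ffunE.
by move=> kS; apply/ffunP => i; rewrite ffunE; exact: kS.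
Qed.

Lemma rounding_learner_replicable (H : set {mfun X >-> bool}) :
  (0 < d)%N -> sq_learns H A nu -> l = certificate_length d ->
  (forall eps delta, 0 < nu eps < 1 -> 0 < delta < 1 ->
     64 * sample_bound d (nu eps) delta <= (m eps delta)%:R) ->
  certificate_replicable H rounding_learner.
Proof.
move=> d0 learns lE mbound eps delta eps01 delta01.
split=> [r h|D f Hf]; first exact: measurable_rounding_learner.
have [nu0 /(_ D f Hf) {}learns] := learns eps eps01.
set P := labeled D f in learns *.
have /choice[p pP] i : exists p, ('E_P[query A eps i] = p%:E)%E /\ 0 <= p <= 1.
  by have [p] := expectation_unit P (query_range A eps i); exists p.
have pE i := (pP i).1; have p01 i := (pP i).2.
have delta0 : 0 < delta by case/andP: delta01.
have K0 : 0 < 2 ^+ l delta :> R by rewrite exprn_gt0.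
have cardT : #|{: (l delta).-tuple bool}|%:R = 2 ^+ l delta :> R.
  by rewrite card_tuple card_bool natrX.
(* Lengths are measured in cells of width [2 * nu eps], so this radius corresponds to [nu eps / K]
   with [K = 2 ^+ l delta]. *)
pose bad (r : (l delta).-tuple bool) := exists i, near_int
  (2 * #|{: (l delta).-tuple bool}|%:R)^-1 (p i / (2 * nu eps) - offset r).
apply: (uniform_pr_ge (F := bad) (card_near_int_le _)).
  rewrite ler_pdivrMr// mulrC -ler_pdivrMr// lE.
  by have /andP[] := certificate_length_bounds d0 delta01.
have stat v i : `|v - p i| <= nu eps -> stat_answer P (nu eps) (query A eps i) v.
  by move=> vp; rewrite /stat_answer pE -EFinB /= lee_fin.
move=> r good; rewrite /rounding_learner; have [nu1|nu1] := leP 1 (nu eps).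
  exists (output A eps (fun=> 2^-1)); split.
    apply: learns => i; apply: stat; apply: le_trans nu1.
    by rewrite ler_norml; have := p01 i; lra.
  rewrite (_ : [set S | _] = setT); last by apply/seteqP.
  by rewrite probability_setT lee_fin gerBl ltW.
(* The replicated hypothesis comes from the rounded true means, so it depends on [r] but not on the
   sample. Half of the cell width is [nu eps], which makes these answers legal. *)
exists (output A eps (rounded_answers eps r p)); split.
  apply: learns => i; apply: stat.
  apply: le_trans (round_at_error _ _ _) _; first by rewrite mulr_gt0.
  by rewrite mulrC mulKf.
have ms := mbound eps delta (introT andP (conj nu0 nu1)) delta01.
have m0 : (0 < m eps delta)%N.
  rewrite -(ltr0n R) (lt_le_trans _ ms)// mulr_gt0// (lt_le_trans ltr01)//.
  by apply: sample_bound_ge1 => //; apply/andP.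
pose a := nu eps / 2 ^+ l delta.
have K1 : 1 <= 2 ^+ l delta :> R by rewrite exprn_ege1// ler1n.
have a2 : 0 < a <= 2.
  rewrite divr_gt0//= ler_pdivrMr//; lra.
pose close := [set S : (m eps delta).-tuple (X * bool)%type |
  forall i, `|sample_mean (query A eps i) S - p i| < a].
apply: (@le_trans _ _ (iid P (m eps delta) close)).
  apply: le_trans (iid_sample_means_close m0 (query_range A eps) pE a2).
  rewrite lee_fin lerD2l lerN2 /a lE; exact: tail_le_delta.
have mclose : measurable close by exact: measurable_sample_means_close.
have mB := @measurable_rounding_learner eps delta r
  (output A eps (rounded_answers eps r p)).
rewrite /rounding_learner leNgt nu1 /= in mB.
apply: le_measure; rewrite ?inE//.
move=> S /= cl; congr (output A eps); apply/funext => i.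
rewrite /rounded_answers /round_at.
congr (_ * (_%:~R + _ + _)).
(* In units of the cell width, [a] is exactly this radius, so for good [r] the empirical and true
   means fall into the same cell. *)
apply: (@floor_eq_near _ (2 * #|{: (l delta).-tuple bool}|%:R)^-1).
  by move=> near; apply: good; exists i.
rewrite (_ : _ - _ = (sample_mean (query A eps i) S - p i) / (2 * nu eps)); last by ring.
rewrite normrM normfV (gtr0_norm (_ : 0 < 2 * nu eps)) ?mulr_gt0//.
rewrite ltr_pdivrMr ?mulr_gt0// cardT; apply: (lt_le_trans (cl i)).
rewrite /a le_eqVlt; apply/orP; left; apply/eqP; field.
by rewrite gt_eqF.
Qed.

End learner.

(** * The sample size with an absolute constant *)

Theorem theorem5p7 (R : realType) :
  exists C : R, 0 < C /\
    forall (disp : measure_display) (X : measurableType disp)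
      (H : set {mfun X >-> bool}) (d : nat) (nu : R -> R),
      (0 < d)%N ->
      nonadaptive_sq_learnable H d nu ->
      exists n : R -> R -> nat,
        (forall v delta : R, 0 < v -> 0 < delta < 1 ->
           (n v delta)%:R <= C * sample_bound d v delta) /\
        certificate_replicably_learnable H (certificate_length d)
          (fun eps delta => n (nu eps) delta).
Proof.
(* The tail bound requires 64 times [sample_bound]. Truncation loses less than 1, which one more
   copy covers because [sample_bound] is at least 1 when [nu eps < 1]. *)
exists 65; split=> // disp X H d nu d0 [A learns].
exists (fun v delta => Num.truncn (65 * sample_bound d v delta)); split.
  move=> v delta v0 /andP[delta0 delta1]; rewrite truncn_le mulr_ge0//.
  rewrite /sample_bound !mulr_ge0 ?invr_ge0 ?mulr_ge0 ?exprn_ge0 ?ltW//.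
  - by rewrite ltr0n.
  - by rewrite ltr0n.
  - by rewrite lt_max ltr01.
exists (@rounding_learner _ _ _ _ A nu _ _).
apply: rounding_learner_replicable => // eps delta nu01 delta01.
have := truncnS_gt (65 * sample_bound d (nu eps) delta).
have := sample_bound_ge1 d0 nu01 delta01.
by rewrite -natr1; lra.
Qed.
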